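(* Let $K$ be a compact line, let $G: K \to \mathbb{R}$ be a nondecreasing, positive, and amenable function, and let $\mu_G$ denote the Radon measure on $K$ induced by $G$. Then a Borel measurable function $f\colon K\to\mathbb{R}$ is Lebesgue $\mu_G$-integrable if and only if both $f$ and $|f|$ are $G$-integrable. In that case, \[\int_K f\,dG = \int_K f\,d\mu_G.\]
   Context: A compact line is a nonempty linearly ordered set $K$ whose order topology is compact; $0_K$ and $1_K$ denote its least and greatest elements (they exist), and intervals are written as usual, e.g. $(x,y]=\{z\in K: x<z\le y\}$. An open interval of $K$ is an interval that is an open subset of $K$. Integral. A partition of $K$ is $P=\{([x_{i-1},x_i],t_i):1\le i\le n\}$ with $0_K=x_0\le x_1\le\dots\le x_n=1_K$ in $K$ and $t_i\in[x_{i-1},x_i]$. A gauge on $K$ is a function $\delta$ assigning to each $x\in K$ an open interval $\delta(x)$ of $K$ with $x\in\delta(x)$. $P$ is $\delta$-fine, written $P\ll\delta$, if $(x_{i-1},x_i]\subset\delta(t_i)$ for all $i$. For $f,G:K\to\mathbb R$ set $S(f,G,P)=f(0_K)G(0_K)+\sum_{i=1}^n f(t_i)(G(x_i)-G(x_{i-1}))$. The function $f$ is $G$-integrable, with integral $\int_K f\,dG=A\in\mathbb R$, if for each $\varepsilon>0$ there is a gauge $\delta$ on $K$ such that $|S(f,G,P)-A|<\varepsilon$ for every $P\ll\delta$. A point $x\in[0_K,1_K)$ is right-dense if every neighborhood of $x$ contains a point greater than $x$; $x\in(0_K,1_K]$ is left-dense if every neighborhood of $x$ contains a point less than $x$. A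 function $G:K\to\mathbb R$ is amenable if it is right-continuous (at each $x\in[0_K,1_K)$, for every $\varepsilon>0$ there is a neighborhood $V$ of $x$ with $|G(y)-G(x)|<\varepsilon$ for $y\in V\cap[x,1_K]$) and regulated (the left-hand limit exists in $\mathbb R$ at every left-dense point and the right-hand limit exists in $\mathbb R$ at every right-dense point). For $G$ nondecreasing, positive and amenable, $\mu_G$ is the unique positive Radon (finite regular Borel) measure on $K$ with $\mu_G([0_K,x])=G(x)$ for all $x\in K$. *)

(* Defs.v *)
From HB Require Import structures.
From mathcomp Require Import all_boot all_order all_algebra.
From mathcomp Require Import all_classical all_reals all_analysis.

Set Implicit Arguments.
Unset Strict Implicit.
Unset Printing Implicit Defensive.

Import Order.TTheory GRing.Theory Num.Theory.
Import numFieldNormedType.Exports.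

Local Open Scope classical_set_scope.
Local Open Scope ring_scope.

HB.mixin Record Topological_isCompact T & Topological T := {
  compact_space : compact [set: T]
}.

(* The endpoints [0_K] and [1_K] are [\bot] and [\top]; a compact line always
   has them, and their existence says that [K] is nonempty. *)
#[short(type="compactLineType")]
HB.structure Definition CompactLine d :=
  { K of OrderTopological d K & Order.TBTotal d K & Topological_isCompact K }.

Section integral.
Context {d : Order.disp_t} {K : compactLineType d} {R : realType}.
Implicit Types (x y : K) (f G : K -> R).

Definition open_interval (A : set K) :=
  open A /\ exists i : interval K, A = [set` i].

Definition is_gauge (delta : K -> set K) :=
  forall x, open_interval (delta x) /\ delta x x.

(* The intervals are indexed from 0: the [i]-th one, [i < nb_itv], goes from
   [endpt i] to [endpt i.+1] and has tag [itv_tag i] (the usual t_{i+1}).  The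
   values of [endpt] beyond [nb_itv], and of [itv_tag] from [nb_itv] on, are
   never used. *)
Record tagged_partition := TaggedPartition {
  nb_itv : nat;
  endpt : nat -> K;
  itv_tag : nat -> K;
  endpt_first : endpt 0%N = \bot%O;
  endpt_last : endpt nb_itv = \top%O;
  endpt_le : forall i, (i < nb_itv)%N -> (endpt i <= endpt i.+1)%O;
  itv_tag_in : forall i, (i < nb_itv)%N ->
    itv_tag i \in `[endpt i, endpt i.+1]
}.

Definition is_fine (delta : K -> set K) (P : tagged_partition) :=
  forall i, (i < nb_itv P)%N ->
    `]endpt P i, endpt P i.+1] `<=` delta (itv_tag P i).

Definition riemann_sum f G (P : tagged_partition) : R :=
  f \bot%O * G \bot%O +
  \sum_(i < nb_itv P) f (itv_tag P i) * (G (endpt P i.+1) - G (endpt P i)).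

Definition has_G_integral G f (A : R) :=
  forall e : R, 0 < e -> exists2 delta : K -> set K, is_gauge delta &
    forall P : tagged_partition, is_fine delta P ->
      `|riemann_sum f G P - A| < e.

Definition G_integrable G f := exists A : R, has_G_integral G f A.

(* The value of the integral; unspecified when [f] is not [G]-integrable. *)
Definition G_integral G f : R := get (has_G_integral G f).

Definition right_dense x :=
  (x < \top)%O /\ forall V, nbhs x V -> exists2 y, V y & (x < y)%O.

Definition left_dense x :=
  (\bot < x)%O /\ forall V, nbhs x V -> exists2 y, V y & (y < x)%O.

Definition line_right_continuous G := forall x, (x < \top)%O ->
  G y @[y --> within `[x, \top%O] (nbhs x)] --> G x.

Definition regulated G :=
  (forall x, left_dense x ->
     exists l : R, G y @[y --> within `[\bot%O, x[ (nbhs x)] --> l) /\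
  (forall x, right_dense x ->
     exists l : R, G y @[y --> within `]x, \top%O] (nbhs x)] --> l).

Definition amenable G := line_right_continuous G /\ regulated G.

End integral.

(* [g_sigma_algebraType] is a [measurableType] only over a [pointedType]: [\bot]
   is taken as the (irrelevant) distinguished point of a copy of [K]. *)
Definition pointed_line {d : Order.disp_t} (K : compactLineType d) : Type := K.

HB.instance Definition _ (d : Order.disp_t) (K : compactLineType d) :=
  Choice.on (pointed_line K).
HB.instance Definition _ (d : Order.disp_t) (K : compactLineType d) :=
  isPointed.Build (pointed_line K) (\bot%O : K).

Notation borelType K := (@g_sigma_algebraType (pointed_line K) (@open K)).

Section radon.
Context {d : Order.disp_t} {K : compactLineType d} {R : realType}.
Local Open Scope ereal_scope.

Definition regular_measure (mu : {finite_measure set (borelType K) -> \bar R}) :=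
  forall A : set (borelType K), measurable A ->
    mu A = ereal_inf [set mu U | U in [set U : set K | open U /\ A `<=` U]] /\
    mu A = ereal_sup [set mu C | C in [set C : set K | compact C /\ C `<=` A]].

(* [mu] is the Radon measure [mu_G]: a regular finite Borel measure, and these
   values determine it. *)
Definition radon_measure_of (G : K -> R)
    (mu : {finite_measure set (borelType K) -> \bar R}) :=
  regular_measure mu /\ forall x : K, mu `[\bot%O, x]%classic = (G x)%:E.

End radon.

(* Main.v *)
Require Import Defs.
From mathcomp Require Import all_boot all_order all_algebra.
From mathcomp Require Import all_classical all_reals all_analysis.
From mathcomp Require Import measurable_realfun ring lra.

Set Implicit Arguments.
Unset Strict Implicit.
Unset Printing Implicit Defensive.

Import Order.TTheory GRing.Theory Num.Theory.
Import numFieldNormedType.Exports.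

Local Open Scope classical_set_scope.
Local Open Scope ring_scope.

(* A Riemann sum is the [mu]-integral of the step function taking the value
   [f (t_i)] on [(x_(i-1), x_i]].  If [f] is [mu]-integrable, cover the line by
   countably many Borel level sets [E n] on which [f] oscillates little, and
   let the gauge at [x \in E n] lie in an open [U n] containing [E n]; by outer
   regularity and absolute continuity, [U n] can be chosen so that the integral
   of [|f|] plus a constant over [U n \ E n] is tiny.  Then [|f x - f y|] is
   dominated, for [y] in the gauge at [x], by a function [h y] of small
   integral, so Riemann sums of fine partitions are close to the integral of [f].
   Conversely, if [|f|] is [G]-integrable, each truncation [min(|f|, n)] has the
   same [G]- and [mu]-integral by the first part; this integral is at most the
   [G]-integral of [|f|] because fine partitions exist (Cousin's lemma), and
   monotone convergence concludes. *)

(** * Compactness of the line and Cousin's lemma *)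

(** If [A] had no greatest element, the open sets where [le b a] fails, for [b] in [A], would cover
    [A]. They are directed upwards, so a single one would contain [A], including its own [b]. An
    abstract relation serves maxima and minima alike. *)
Lemma compact_greatest (T : topologicalType) (le : rel T) (A : set T) :
  total le -> transitive le -> (forall b, open [set a | ~~ le b a]) ->
  compact A -> A !=set0 -> exists2 m, A m & forall a, A a -> le a m.
Proof.
move=> le_total le_trans le_open /compact_near_coveringP Acov [a0 Aa0].
apply: contrapT => nomax.
have larger b : A b -> exists2 a, A a & ~~ le a b.
  move=> Ab; apply: contrapT => nolarger; apply: nomax; exists b => // a Aa.
  by apply: contrapT => /negP ab; apply: nolarger; exists a.
have lexx x : le x x by have := le_total x x; rewrite orbb.
pose F := filter_from A (fun b => [set c | A c /\ le b c]).
have FF : Filter F.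
  apply: filter_from_filter; first by exists a0.
  move=> b c Ab Ac; case/orP: (le_total b c) => bc.
    by exists c => // x [Ax cx]; split; split => //; apply: le_trans cx.
  by exists b => // x [Ax cx]; split; split => //; apply: le_trans cx.
have [|b Ab] := Acov T F (fun c x => ~~ le c x) FF.
  move=> x Ax; have [b Ab nbx] := larger x Ax.
  exists ([set a | ~~ le b a], [set c | A c /\ le b c]) => /=.
    by split; [exact: open_nbhs_nbhs | exists b].
  move=> [y c] /= [nby [Ac bc]]; apply: contra nby; exact: le_trans.
by move=> /(_ b (conj Ab (lexx b)) b Ab) /=; rewrite lexx.
Qed.

Section compact_line.
Context {d : Order.disp_t} {K : compactLineType d}.
Implicit Types (x y : K) (A U : set K) (delta : K -> set K).

Lemma closed_has_max A : closed A -> A !=set0 ->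
  exists2 m, A m & forall a, A a -> (a <= m)%O.
Proof.
move=> Acl; apply: (@compact_greatest K (fun x y => x <= y)%O).
- exact: le_total.
- exact: le_trans.
- move=> b; apply: (eq_ind _ open (lray_open b)).
  by apply/seteqP; split => x /=; rewrite in_itv /= -ltNge.
- exact: (subclosed_compact Acl compact_space).
Qed.

Lemma closed_has_min A : closed A -> A !=set0 ->
  exists2 m, A m & forall a, A a -> (m <= a)%O.
Proof.
move=> Acl; apply: (@compact_greatest K (fun x y => y <= x)%O).
- by move=> x y; exact: le_total.
- by move=> y x z yx zy; apply: le_trans yx.
- move=> b; apply: (eq_ind _ open (rray_open b)).
  by apply/seteqP; split => x /=; rewrite in_itv /= ?andbT -ltNge.
- exact: (subclosed_compact Acl compact_space).
Qed.

Lemma open_interval_sub U x : open U -> U x ->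
  exists2 V, open_interval V & V x /\ V `<=` U.
Proof.
move=> oU Ux; have : nbhs x U by apply: open_nbhs_nbhs.
rewrite itv_nbhsE => -[i [oi xi] iU].
by exists [set` i] => //; split; [exact: itv_open_ends_open | exists i].
Qed.

Lemma open_interval_itvoc U x y : open_interval U -> U x -> U y ->
  `]x, y] `<=` U.
Proof.
move=> [_ [[l r] ->]] /=; rewrite !itv_boundlr => /andP[lx _] /andP[_ yr] z /=.
rewrite in_itv /= => /andP[xz zy]; rewrite itv_boundlr; apply/andP; split.
  by apply: le_trans lx _; rewrite bnd_simp ltW.
by apply: le_trans yr; rewrite bnd_simp.
Qed.

Lemma open_intervalI U V : open_interval U -> open_interval V ->
  open_interval (U `&` V).
Proof.
move=> [oU [i Ui]] [oV [j Vj]]; split; first exact: openI.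
by exists (itv_meet i j); rewrite Ui Vj -set_itvI.
Qed.

Lemma is_gaugeI delta1 delta2 : is_gauge delta1 -> is_gauge delta2 ->
  is_gauge (fun x => delta1 x `&` delta2 x).
Proof.
move=> g1 g2 x; have [iU Ux] := g1 x; have [iV Vx] := g2 x.
by split => //; exact: open_intervalI.
Qed.

Lemma is_fineI delta1 delta2 (P : @tagged_partition d K) :
  is_fine (fun x => delta1 x `&` delta2 x) P ->
  is_fine delta1 P /\ is_fine delta2 P.
Proof. by move=> fP; split => i /fP PI z /PI[]. Qed.

(* [fine_reach delta x] means that [[\bot, x]] has a fine partition; the two
   constructors build it interval by interval. *)
Inductive fine_reach delta : K -> Prop :=
| fine_reach_bot : fine_reach delta \bot%O
| fine_reach_step x y t : fine_reach delta x -> t \in `[x, y] ->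
    `]x, y] `<=` delta t -> fine_reach delta y.

Lemma fine_reach_partition delta y : fine_reach delta y ->
  exists n (e t : nat -> K), [/\ e 0%N = \bot%O, e n = y &
    forall i, (i < n)%N ->
      t i \in `[e i, e i.+1] /\ `]e i, e i.+1] `<=` delta (t i)].
Proof.
elim=> [|{}x {}y t _ [n [e [s [e0 en es]]]] txy xyt].
  by exists 0%N, (fun=> \bot%O), (fun=> \bot%O).
exists n.+1, (fun i => if (i <= n)%N then e i else y),
  (fun i => if (i < n)%N then s i else t).
split => //; first by rewrite ltnn.
move=> i; rewrite ltnS /=; case: ltngtP => // [lin|->] _; first exact: es.
by rewrite en.
Qed.

(** Let [s] be the largest point of the closure of the reachable set. The gauge at [s] makes [s]
    itself reachable, and if [s] were not the top, one more interval would reach beyond it. *)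
Lemma cousin delta : is_gauge delta -> exists P, is_fine delta P.
Proof.
move=> gdelta; pose C := [set x | fine_reach delta x].
have itvxx x y : (x <= y)%O -> (x \in `[x, y]) /\ (y \in `[x, y]).
  by move=> xy; rewrite !in_itv /= !lexx xy.
have [|s Cs smax] := @closed_has_max (closure C) (@closed_closure _ C).
  by exists \bot%O; apply: subset_closure; exact: fine_reach_bot.
have [gs ss] := gdelta s.
(* A reachable [c] in [delta s] exists, and [c <= s], so the interval from [c] to [s] can be tagged
   by [s]. *)
have reach_s : C s.
  have [|c [Cc sc]] := Cs (delta s).
    by apply: open_nbhs_nbhs; split => //; case: gs.
  have cs : (c <= s)%O by apply/smax/subset_closure.
  apply: (fine_reach_step Cc (itvxx _ _ cs).2).
  exact: open_interval_itvoc.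
have sT : s = \top%O.
  apply/eqP; rewrite -[_ == _]negbK; apply/negP => sNT.
  have s_lt_top : (s < \top)%O by rewrite lt_neqAle sNT lex1.
  suff [y sy Cy] : exists2 y, (s < y)%O & C y.
    by move: sy; rewrite ltNge smax//; exact: subset_closure.
  have [[y sy dy]|nody] := pselect (exists2 y, (s < y)%O & delta s y).
    exists y => //; apply: (fine_reach_step reach_s (itvxx _ _ (ltW sy)).1).
    exact: open_interval_itvoc.
  (* When [delta s] has no point beyond [s], the open ray above [s] is also closed, so it has a
     least element: the immediate successor of [s]. *)
  have rayE : `]s, +oo[%classic = ~` (`]-oo, s[ `|` delta s).
    apply/seteqP; split => z /=; rewrite !in_itv /= andbT.
      move=> sz [|dz]; first by rewrite ltNge (ltW sz).
      by apply: nody; exists z.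
    move=> /not_orP[/negP zs nz]; rewrite lt_neqAle leNgt zs andbT.
    by apply/eqP => sz; apply: nz; rewrite -sz.
  have [||y] := @closed_has_min `]s, +oo[.
  - rewrite rayE; apply: open_closedC; apply: openU; first exact: lray_open.
    by case: gs.
  - by exists \top%O; rewrite /= in_itv /= s_lt_top.
  rewrite /= in_itv /= andbT => sy ymin; exists y => //.
  (* The tag is now [y], not [s]: the half-open interval from [s] to [y] is reduced to [y], which
     lies in its own gauge. *)
  apply: (fine_reach_step reach_s (itvxx _ _ (ltW sy)).2) => z /=.
  rewrite in_itv /= => /andP[sz zy].
  have -> : z = y by apply/le_anti; rewrite zy ymin //= in_itv /= sz.
  by have [] := gdelta y.
move: reach_s; rewrite sT => /fine_reach_partition[n [e [t [e0 en et]]]].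
have ele i : (i < n)%N -> (e i <= e i.+1)%O.
  by move=> /et[]; rewrite in_itv /= => /andP[ei ti] _; exact: le_trans ti.
exists (TaggedPartition e0 en ele (fun i lin => (et i lin).1)).
by move=> i lin; exact: (et i lin).2.
Qed.

End compact_line.

(** * Riemann sums as integrals of step functions *)

Section riemann_sum_as_integral.
Context {d : Order.disp_t} {K : compactLineType d} {R : realType}.
Implicit Types (x y : K) (delta : K -> set K) (P : @tagged_partition d K).

Lemma open_measurable_line (U : set K) :
  open U -> measurable (U : set (borelType K)).
Proof. exact: sub_sigma_algebra. Qed.

Lemma lray_measurable_line x : measurable (`]-oo, x] : set (borelType K)).
Proof.
rewrite -setCitvr; apply: measurableC; apply: open_measurable_line.
exact: rray_open.
Qed.

Lemma itvoc_measurable_line x y : measurable (`]x, y] : set (borelType K)).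
Proof.
rewrite set_itv_splitI; apply: measurableI; last exact: lray_measurable_line.
by apply: open_measurable_line; exact: rray_open.
Qed.

(** The indicator of the bottom point accounts for the term [f \bot * G \bot] of a Riemann sum. The
    number [m] of intervals is a parameter to allow induction. *)
Definition tagged_step (f : K -> R) P (m : nat) (y : K) : R :=
  f \bot%O * \1_[set \bot%O] y +
  \sum_(i < m) f (itv_tag P i) * \1_(`]endpt P i, endpt P i.+1]) y.

(** The bottom point and the half-open intervals partition the line, so exactly one summand is
    selected at [y]; fineness puts [y] in the gauge of its tag. *)
Lemma tagged_step_fine f delta P y : is_gauge delta -> is_fine delta P ->
  exists2 x, delta x y & tagged_step f P (nb_itv P) y = f x.
Proof.
move=> gdelta fP.
(* Beyond [endpt P m] the partial step function must be known to vanish, so that the next interval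
   alone sets its value there. *)
suff steps m : (m <= nb_itv P)%N ->
    if (y <= endpt P m)%O then exists2 x, delta x y & tagged_step f P m y = f x
    else tagged_step f P m y = 0.
  by have := steps _ (leqnn _); rewrite endpt_last lex1.
elim: m => [_|m IHm lt_mn].
  rewrite endpt_first /tagged_step big_ord0 addr0 indicE in_set1 lex0.
  case: eqP => [->|_] /=; last by rewrite mulr0.
  by rewrite mulr1; exists \bot%O => //; have [] := gdelta \bot%O.
have le_m := endpt_le lt_mn.
have stepS : tagged_step f P m.+1 y = tagged_step f P m y +
    f (itv_tag P m) * \1_(`]endpt P m, endpt P m.+1]) y.
  by rewrite /tagged_step big_ord_recr /= addrA.
have := IHm (ltnW lt_mn); rewrite stepS indicE mem_setE in_itv /=.
case: (leP y (endpt P m)) => [ym [x dxy ->]|my ->].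
  by rewrite (le_trans ym le_m); exists x => //; rewrite andFb mulr0 addr0.
case: ifP => ym1; last by rewrite ym1 mulr0 addr0.
exists (itv_tag P m); last by rewrite ym1 mulr1 add0r.
by apply: (fP m lt_mn); rewrite /= in_itv /= my.
Qed.

Context (G : K -> R) (mu : {finite_measure set (borelType K) -> \bar R}).
Hypothesis muG : forall x, mu `[\bot%O, x]%classic = (G x)%:E.

Lemma measure_itvoc x y : (x <= y)%O ->
  mu `]x, y]%classic = (G y - G x)%:E.
Proof.
move=> xy.
have itv_bot z : `[\bot%O, z]%classic = `]-oo, z]%classic :> set K.
  by apply/seteqP; split => w /=; rewrite !in_itv /= le0x.
have -> : `]x, y]%classic = `]-oo, y] `\` `]-oo, x] :> set K.
  apply/seteqP; split => w /=; rewrite !in_itv /= ltNge.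
    by move=> /andP[/negP].
  by move=> [-> /negP ->].
rewrite measureD; [|exact: lray_measurable_line|exact: lray_measurable_line|].
  have -> : `]-oo, y] `&` `]-oo, x] = `]-oo, x]%classic :> set K.
    apply/seteqP; split => w /=; rewrite !in_itv /=; first by case.
    by move=> wx; rewrite wx (le_trans wx xy).
  by rewrite -!itv_bot EFinB; congr (_ - _)%E; exact: muG.
by rewrite -ge0_fin_numE// fin_num_measure//; exact: lray_measurable_line.
Qed.

Lemma set1_bot_itv : [set \bot%O : K] = `[\bot%O, \bot%O]%classic.
Proof. by rewrite set_itv1. Qed.

Lemma measurable_bot : measurable ([set \bot%O] : set (borelType K)).
Proof.
rewrite (_ : [set \bot%O] = `]-oo, \bot%O]%classic).
  exact: lray_measurable_line.
by apply/seteqP; split => w /=; rewrite in_itv /= lex0 => /eqP.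
Qed.

Lemma integrable_scale_indic (a : R) (A : set (borelType K)) : measurable A ->
  mu.-integrable setT (fun y => (a * \1_A y)%:E).
Proof.
move=> mA; under eq_fun do rewrite EFinM.
by apply: integrableZl => //; exact: integrable_indic.
Qed.

Lemma integral_scale_indic (a : R) (A : set (borelType K)) : measurable A ->
  (\int[mu]_y (a * \1_A y)%:E = a%:E * mu A)%E.
Proof.
move=> mA; under eq_integral do rewrite EFinM.
rewrite integralZl//; last exact: integrable_indic.
by rewrite integral_indic// setIT.
Qed.

Lemma tagged_step_integrable f P m :
  mu.-integrable setT (EFin \o (tagged_step f P m : borelType K -> R)).
Proof.
rewrite /comp; under eq_fun do rewrite /tagged_step EFinD -sumEFin.
apply: integrableD => //; first exact: integrable_scale_indic measurable_bot.
apply: integrable_sum => // i _.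
exact: integrable_scale_indic (itvoc_measurable_line _ _).
Qed.

Lemma integral_tagged_step f P :
  (\int[mu]_y (tagged_step f P (nb_itv P) y)%:E = (riemann_sum f G P)%:E)%E.
Proof.
under eq_integral do rewrite /tagged_step EFinD -sumEFin.
rewrite integralD//=; first last.
- apply: integrable_sum => // i _.
  exact: integrable_scale_indic (itvoc_measurable_line _ _).
- exact: integrable_scale_indic measurable_bot.
rewrite integral_sum//; last first.
  by move=> i; exact: integrable_scale_indic (itvoc_measurable_line _ _).
rewrite /riemann_sum EFinD EFinM -sumEFin; congr (_ + _)%E.
  by rewrite integral_scale_indic ?set1_bot_itv ?muG// -set1_bot_itv;
    exact: measurable_bot.
apply: eq_bigr => i _.
rewrite integral_scale_indic; last exact: itvoc_measurable_line.
by rewrite measure_itvoc//; exact: endpt_le.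
Qed.

(** The error of a fine Riemann sum is at most the integral of the distance between [f] and the step
    function. The latter takes at [y] a value [f x] with [y] in [delta x], so [h] dominates this
    distance. *)
Lemma has_G_integral_of_oscillation (f : borelType K -> R) :
  mu.-integrable setT (EFin \o f) ->
  (forall e : R, 0 < e -> exists2 delta : K -> set K, is_gauge delta &
    exists h : borelType K -> \bar R, [/\ measurable_fun [set: borelType K] h,
      forall y, (0 <= h y)%E, (\int[mu]_y h y < e%:E)%E &
      forall x y, delta x y -> (`|f x - f y|%:E <= h y)%E]) ->
  has_G_integral G f (fine (\int[mu]_y (f y)%:E)).
Proof.
move=> intf osc e e0; have [delta gdelta [h [mh h0 inth hosc]]] := osc e e0.
exists delta => // P fP; pose s : borelType K -> R := tagged_step f P (nb_itv P).
have ints : mu.-integrable setT (EFin \o s) by exact: tagged_step_integrable.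
rewrite -lte_fin; apply: le_lt_trans inth.
rewrite -abse_EFin EFinB fineK; last exact: integrable_fin_num intf.
rewrite -integral_tagged_step -integralB_EFin//.
have msf : measurable_fun [set: borelType K] (fun y => ((s y)%:E - (f y)%:E)%E).
  by apply: measurable_int (integrableB _ ints intf).
apply: le_trans (le_abse_integral _ _ msf) _ => //.
apply: ge0_le_integral => //; first exact: measurableT_comp.
move=> y _; have [x dxy sE] := tagged_step_fine f y gdelta fP.
by rewrite /s sE; exact: hosc.
Qed.

End riemann_sum_as_integral.

(** * Gauges controlling the oscillation of an integrable function *)

Section oscillation.
Context {d : Order.disp_t} {K : compactLineType d} {R : realType}.
Context (mu : {finite_measure set (borelType K) -> \bar R}).
Hypothesis mu_regular : regular_measure mu.

(** By absolute continuity it suffices that the difference of [U] and [A] has small measure, which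
    outer regularity provides. *)
Lemma outer_regular_integral (g : borelType K -> R) (A : set (borelType K))
    (e : R) :
  measurable A -> mu.-integrable setT (EFin \o g) -> 0 < e ->
  exists2 U : set K, open U /\ A `<=` U &
    (\int[mu]_(y in (U `\` A : set (borelType K))) `|g y|%:E <= e%:E)%E.
Proof.
move=> mA intg e0; have [r [r0 small]] := integral_normr_continuous intg e0.
have muAfin : mu A \is a fin_num by exact: fin_num_measure.
have [muAinf _] := mu_regular mA.
have [|_ [U [oU AU] <-] UA] := @lb_ereal_inf_adherent R
    [set mu U | U in [set U : set K | open U /\ A `<=` U]] r r0.
  by rewrite -muAinf.
rewrite -muAinf in UA.
have mU : measurable (U : set (borelType K)) by exact: open_measurable_line.
have mUA : measurable (U `\` A : set (borelType K)) by exact: measurableD.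
exists U => //; have := small _ mUA; rewrite /Rintegral => smallUA.
have intUA : mu.-integrable (U `\` A : set (borelType K))
    (fun y => `|g y|%:E).
  by apply: integrableS (integrable_abse intg).
rewrite -[leLHS]fineK; last exact: integrable_fin_num intUA.
rewrite lee_fin ltW// smallUA// measureD//; last first.
  by rewrite -ge0_fin_numE// fin_num_measure.
have -> : U `&` A = A by apply/setIidPr.
by rewrite lteBlDr// addeC.
Qed.

Lemma integrable_oscillation (f : borelType K -> R) (e : R) :
  mu.-integrable setT (EFin \o f) -> 0 < e ->
  exists2 delta : K -> set K, is_gauge delta &
    exists h : borelType K -> \bar R, [/\ measurable_fun [set: borelType K] h,
      forall y, (0 <= h y)%E, (\int[mu]_y h y <= e%:E)%E &
      forall x y, delta x y -> (`|f x - f y|%:E <= h y)%E].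
Proof.
move=> intf e0.
have mf : measurable_fun [set: borelType K] f.
  by apply/measurable_EFinP; exact: measurable_int intf.
pose M := fine (mu [set: borelType K]).
have muT : mu [set: borelType K] = M%:E by rewrite /M fineK// fin_num_measure.
have M0 : 0 <= M by rewrite -lee_fin -muT.
(* Chosen so that [2 * eta * (M + 1) = e / 2]: the constant part [2 * eta] of [h] then costs at most
   [e / 2]. Adding 1 covers the case [M = 0]. *)
pose eta := e / (4 * (M + 1)).
have eta0 : 0 < eta by rewrite divr_gt0// mulr_gt0// ltr_wpDl.
(* An enumeration of the rationals; integers coding none are sent to 0, which is harmless since the
   sets [E n] may overlap. *)
pose q (n : nat) : R := ratr (odflt 0 (unpickle n : option rat)).
pose E n : set (borelType K) := f @^-1` `]q n - eta, q n + eta[.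
have mE n : measurable (E n) by rewrite -[E n]setTI; exact: mf.
have Ecover x : exists n, E n x.
  have [r] := @rat_in_itvoo R (f x - eta) (f x + eta) ltac:(lra).
  rewrite in_itv /= => /andP[r1 r2]; exists (pickle r).
  by rewrite /E /= in_itv /= /q pickleK /=; lra.
pose g n (y : borelType K) : R := `|q n| + `|f y|.
have g0 n y : 0 <= g n y by rewrite addr_ge0.
have intg n : mu.-integrable setT (EFin \o g n).
  rewrite /comp; under eq_fun do rewrite EFinD.
  apply: integrableD => //; first exact: finite_measure_integrable_cst.
  exact: integrable_abse intf.
(* Geometric budgets, summing over all [n] to the remaining [e / 2]. *)
have e2 n : 0 < e / 2 / (2 ^ n.+1)%:R by rewrite !divr_gt0.
have /choice[U HU] : forall n, exists U : set K, (open U /\ E n `<=` U) /\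
    (\int[mu]_(y in (U `\` E n : set (borelType K))) `|g n y|%:E <=
      (e / 2 / (2 ^ n.+1)%:R)%:E)%E.
  by move=> n; have [U ? ?] := outer_regular_integral (mE n) (intg n) (e2 n);
    exists U.
have mUE n : measurable (U n `\` E n : set (borelType K)).
  by apply: measurableD => //; apply: open_measurable_line; case: (HU n) => -[].
(* The choice of one level set [E (k x)] per point fixes which open set [U (k x)] must contain the
   gauge at [x]. *)
have /choice[k Ek] := Ecover.
have /choice[delta Hdelta] : forall x, exists V : set K,
    open_interval V /\ (V x /\ V `<=` U (k x)).
  move=> x; have [[oU EU] _] := HU (k x).
  by have [V ? ?] := open_interval_sub oU (EU _ (Ek x)); exists V.
exists delta; first by move=> x; have [? []] := Hdelta x.
pose w n : borelType K -> \bar R :=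
  (fun y => (g n y)%:E) \_ (U n `\` E n : set (borelType K)).
have w0 n y : (0 <= w n y)%E.
  by rewrite /w patchE; case: ifP => _ //; rewrite lee_fin.
have mw n : measurable_fun [set: borelType K] (w n).
  apply/(measurable_restrictT _ (mUE n)); apply: measurable_funTS.
  exact: measurable_int (intg n).
pose h y := ((2 * eta)%:E + \sum_(0 <= n <oo) w n y)%E.
have sum0 y : (0 <= \sum_(0 <= n <oo) w n y)%E by exact: nneseries_ge0.
have msum : measurable_fun [set: borelType K]
    (fun y => \sum_(0 <= n <oo) w n y)%E.
  exact: (@ge0_emeasurable_sum _ _ _ _ _ xpredT).
exists h; split.
- exact: emeasurable_funD.
- by move=> y; rewrite adde_ge0// lee_fin mulr_ge0// ltW.
- rewrite /h ge0_integralD//; last by move=> y _; rewrite lee_fin mulr_ge0// ltW.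
  have -> : (\int[mu]_y (2 * eta)%:E = (2 * eta * M)%:E)%E.
    by rewrite integral_cst// [in RHS]EFinM -muT.
  rewrite integral_nneseries//.
  have -> : e = 2 * eta * M + (e - 2 * eta * M) by lra.
  rewrite EFinD leeD2l//.
  have eM : e / 2 <= e - 2 * eta * M.
    have : e / 2 = 2 * eta * (M + 1) by rewrite /eta; field; lra.
    by rewrite mulrDr mulr1; lra.
  apply: (@le_trans _ _ (e / 2)%:E); last by rewrite lee_fin.
  apply: le_trans (epsilon_trick0 xpredT _); last by rewrite divr_ge0// ltW.
  apply: lee_nneseries => [n _ _|n _]; first exact: integral_ge0.
  have [_] := HU n; rewrite /w -integral_mkcond; apply: le_trans.
  by rewrite le_eqVlt; apply/orP; left; apply/eqP; apply: eq_integral => y _;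
    rewrite ger0_norm.
- move=> x y dxy; set n := k x.
  have := Ek x; rewrite /E /= in_itv /= -/n => /andP[x1 x2].
  (* If [y] is in the level set of [x], both values are within [eta] of [q n]. Otherwise [y] is in
     [U n] outside [E n], where the term [w n y] absorbs [f y] and [q n]. *)
  have [Ey|nEy] := pselect (E n y).
    apply: (@le_trans _ _ (2 * eta)%:E); last by rewrite leeDl.
    move: Ey; rewrite /E /= in_itv /= => /andP[y1 y2].
    by rewrite lee_fin ler_norml; lra.
  have Uy : U n y by have [_ [_]] := Hdelta x; exact.
  apply: (@le_trans _ _ ((2 * eta)%:E + w n y)%E); last first.
    rewrite leeD2l//.
    apply: le_trans (nneseries_lim_ge n.+1 (fun i _ _ => w0 i y)).
    by rewrite big_nat_recr//= leeDr// sume_ge0.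
  have -> : w n y = (g n y)%:E by rewrite /w patchE mem_set.
  rewrite -EFinD lee_fin /g.
  have fx : `|f x - q n| <= eta by rewrite ler_norml; lra.
  have -> : f x - f y = (f x - q n) + q n - f y by lra.
  have := ler_normB (f x - q n + q n) (f y).
  have := ler_normD (f x - q n) (q n).
  lra.
Qed.

End oscillation.

(** * Comparison of the two integrals *)

Section comparison.
Context {d : Order.disp_t} {K : compactLineType d} {R : realType}.
Context (G : K -> R).
Hypothesis G_nondecreasing : forall x y : K, (x <= y)%O -> G x <= G y.
Hypothesis G_positive : forall x : K, 0 <= G x.

Lemma riemann_sum_le (f g : K -> R) (P : tagged_partition) :
  (forall x, f x <= g x) -> riemann_sum f G P <= riemann_sum g G P.
Proof.
move=> fg; apply: lerD; first exact: ler_wpM2r.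
apply: ler_sum => i _; apply: ler_wpM2r => //.
by rewrite subr_ge0 G_nondecreasing// endpt_le.
Qed.

(** Both integrals are approximated on one partition fine for both gauges, which exists by Cousin's
    lemma; there the Riemann sums are ordered. *)
Lemma has_G_integral_le (f g : K -> R) (A B : R) :
  has_G_integral G f A -> has_G_integral G g B -> (forall x, f x <= g x) ->
  A <= B.
Proof.
move=> fA gB fg; apply/ler_addgt0Pr => e e0.
have [delta1 g1 fine1] := fA (e / 2) ltac:(lra).
have [delta2 g2 fine2] := gB (e / 2) ltac:(lra).
have [P /is_fineI[/fine1 + /fine2]] := cousin (is_gaugeI g1 g2).
have := riemann_sum_le P fg; rewrite !ltr_norml; lra.
Qed.

Lemma has_G_integral_unique (f : K -> R) (A B : R) :
  has_G_integral G f A -> has_G_integral G f B -> A = B.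
Proof.
move=> fA fB; apply/le_anti/andP.
by split; [exact: has_G_integral_le fA fB _ | exact: has_G_integral_le fB fA _].
Qed.

Context (mu : {finite_measure set (borelType K) -> \bar R}).
Hypothesis mu_G : radon_measure_of G mu.

Lemma integrable_has_G_integral (f : borelType K -> R) :
  mu.-integrable [set: borelType K] (EFin \o f) ->
  has_G_integral G f (fine (\int[mu]_y (f y)%:E)).
Proof.
move=> intf; apply: has_G_integral_of_oscillation => //; first exact: mu_G.2.
move=> e e0.
(* Halving [e] turns the weak bound on the integral of [h] into a strict one. *)
have [delta gdelta [h [mh h0 inth hosc]]] :=
  integrable_oscillation mu_G.1 intf (divr_gt0 e0 (ltr0n _ 2)).
exists delta => //; exists h; split => //.
by apply: le_lt_trans inth _; rewrite lte_fin; lra.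
Qed.

Lemma G_integrable_norm_integrable (f : borelType K -> R) :
  measurable_fun [set: borelType K] f ->
  G_integrable G (fun x => `|f x|) ->
  mu.-integrable [set: borelType K] (EFin \o f).
Proof.
move=> mf [A normA]; apply/integrableP; split; first exact/measurable_EFinP.
pose g (n : nat) (y : borelType K) : R := Num.min `|f y| n%:R.
have g0 n y : 0 <= g n y by rewrite /g le_min normr_ge0/=.
have mg n : measurable_fun [set: borelType K] (g n).
  by apply: measurable_minr => //; exact: measurableT_comp.
have mEg n : measurable_fun [set: borelType K] (fun y => (g n y)%:E).
  exact/measurable_EFinP.
(* Each truncation is bounded by [n] and [mu] is finite. *)
have intg n : mu.-integrable [set: borelType K] (EFin \o g n).
  apply: le_integrable (finite_measure_integrable_cst mu n%:R measurableT) => //.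
    exact: mEg.
  move=> y _ /=; rewrite lee_fin !ger0_norm//.
  by rewrite /g ge_min lexx orbT.
have g_le n : (\int[mu]_y (g n y)%:E <= A%:E)%E.
  rewrite -[leLHS]fineK; last exact: integrable_fin_num (intg n).
  rewrite lee_fin; apply: has_G_integral_le normA _.
    exact: integrable_has_G_integral (intg n).
  by move=> y; rewrite /g ge_min lexx.
have g_homo y : {homo (fun n => (g n y)%:E) : n m / (n <= m)%N >-> (n <= m)%E}.
  move=> n m nm; rewrite lee_fin /g le_min ge_min lexx/= ge_min.
  by rewrite ler_nat nm orbT.
(* For fixed [y] the sequence is constant once [n] exceeds the norm of [f y]. *)
have g_lim y : limn (fun n => (g n y)%:E) = `|(f y)%:E|%E.
  apply/cvg_lim => //; apply: cvg_near_cst.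
  exists (Num.bound `|f y|) => // n /= Nn.
  rewrite /g min_l//; apply: le_trans (ltW (archi_boundP (normr_ge0 _))) _.
  by rewrite ler_nat.
apply: (@le_lt_trans _ _ A%:E); last exact: ltry.
under eq_integral do rewrite -g_lim.
rewrite (monotone_convergence mu)//=.
- apply: lime_le; last exact: nearW.
  apply: ereal_nondecreasing_is_cvgn => n m nm.
  by apply: ge0_le_integral => // y _; [rewrite lee_fin..|exact: g_homo].
- by move=> n y _; rewrite lee_fin.
Qed.

End comparison.

Theorem theorem5p6 (R : realType) (d : Order.disp_t) (K : compactLineType d)
    (G : K -> R)
    (G_nondecreasing : forall x y : K, (x <= y)%O -> G x <= G y)
    (G_positive : forall x : K, 0 <= G x)
    (G_amenable : amenable G)
    (mu : {finite_measure set (borelType K) -> \bar R})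
    (mu_G : radon_measure_of G mu)
    (f : borelType K -> R) (f_borel : measurable_fun [set: borelType K] f) :
  (mu.-integrable [set: borelType K] (EFin \o f) <->
     G_integrable G f /\ G_integrable G (fun x => `|f x|)) /\
  (mu.-integrable [set: borelType K] (EFin \o f) ->
     (G_integral G f)%:E = (\int[mu]_x (f x)%:E)%E).
Proof.
split.
  split=> [intf|[_]]; last exact: G_integrable_norm_integrable.
  split; eexists; first exact: integrable_has_G_integral intf.
  apply: (integrable_has_G_integral mu_G (f := fun x => `|f x|)).
  exact: integrable_abse intf.
move=> intf; have fI := integrable_has_G_integral mu_G intf.
(* [get] returns some integral once one exists; uniqueness then identifies it with the
   [mu]-integral. *)
have GI : has_G_integral G f (G_integral G f) by exact: getPex (ex_intro _ _ fI).
by rewrite (has_G_integral_unique G_nondecreasing G_positive GI fI) fineK//;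
  exact: integrable_fin_num intf.
Qed.
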